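(* Let $T$ be a domain, $M$ a maximal ideal of $T$, $\varphi:T\to k:=T/M$ the natural projection, $D$ a proper subring of $k$, and $R=\varphi^{-1}(D)$. Then $R$ is $t$-potent if and only if each of the following conditions holds: (1) $D$ is $t$-potent (or a field). (2) $N$ is $t$-potent for each maximal $t$-ideal $N$ of $T$ with $N\nsubseteq M$. (3) If $D$ is a field and $M$ is a $t$-ideal of $T$, then $M$ is $t$-potent in $T$.
   Context: For a domain $R$ with quotient field $K$ and a nonzero fractional ideal $I$ of $R$, put $I^{-1}=\{x\in K: xI\subseteq R\}$, $I^v=(I^{-1})^{-1}$, and $I^t=\bigcup J^v$, the union over all nonzero finitely generated subideals $J$ of $I$. A $t$-ideal is a nonzero ideal $I$ with $I^t=I$. A maximal $t$-ideal is an ideal of $R$ maximal among the proper $t$-ideals. A nonzero finitely generated ideal $I$ of $R$ is $t$-rigid if it is contained in exactly one maximal $t$-ideal of $R$. A maximal $t$-ideal of $R$ is $t$-potent if it contains a $t$-rigid ideal, and $R$ is $t$-potent if each of its maximal $t$-ideals is $t$-potent. *)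

(* Defs.v *)
From HB Require Import structures.
From mathcomp Require Import all_boot all_order all_algebra.
From mathcomp Require Import boolp classical_sets.

Set Implicit Arguments.
Unset Strict Implicit.
Unset Printing Implicit Defensive.

Import GRing.Theory.
Local Open Scope ring_scope.
Local Open Scope classical_set_scope.

(* Invertibility is undecidable in a subring or a quotient of a general       *)
(* domain, so the unitRingType structures below use classical choice; the     *)
(* resulting [GRing.unit] is the set of invertible elements.                  *)
Section ClassicalUnits.
Variable A : comNzRingType.

Definition cunit : {pred A} := [pred x : A | `[< exists y, y * x = 1 >]].

Definition cinv (x : A) : A :=
  if pselect (exists y, y * x = 1) is left ex then projT1 (cid ex) else x.

Lemma cmulVr : {in cunit, left_inverse 1 cinv *%R}.
Proof.
move=> x /asboolP x_unit; rewrite /cinv.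
by case: pselect => // ex; case: (cid ex).
Qed.

Lemma cunitP (x y : A) : y * x = 1 -> cunit x.
Proof. by move=> yx; apply/asboolP; exists y. Qed.

Lemma cinv_out : {in [predC cunit], cinv =1 id}.
Proof. by move=> x /asboolPn nx; rewrite /cinv; case: pselect. Qed.

End ClassicalUnits.

Section Subdomain.
Variables (A : idomainType) (S : subringClosed A).

Record subdomain := Subdomain { subdomain_val :> A; _ : subdomain_val \in S }.

HB.instance Definition _ := [isSub for subdomain_val].
HB.instance Definition _ := [Choice of subdomain by <:].
HB.instance Definition _ := [SubChoice_isSubComNzRing of subdomain by <:].
HB.instance Definition _ := GRing.ComNzRing_hasMulInverse.Build subdomain
  (@cmulVr subdomain) (@cunitP subdomain) (@cinv_out subdomain).

Lemma subdomain_integral : GRing.integral_domain_axiom subdomain.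
Proof.
move=> x y /(congr1 val); rewrite rmorphM rmorph0 => /eqP.
by rewrite mulf_eq0 -!(rmorph0 (val : subdomain -> A)) !val_eqE.
Qed.

HB.instance Definition _ :=
  GRing.ComUnitRing_isIntegral.Build subdomain subdomain_integral.

End Subdomain.

(* [idealr R] only contains proper ideals, so [J] ranges over proper ideals. *)
Definition maximal_idealr_axiom (R : nzRingType) (S : {pred R}) : Prop :=
  forall J : idealr R, {subset S <= J} -> {subset J <= S}.

HB.mixin Record isMaximalIdealr (R : nzRingType) (S : R -> bool) := {
  maximal_idealr_subproof : maximal_idealr_axiom S
}.

#[short(type="maximal_idealr")]
HB.structure Definition MaximalIdealr (R : nzRingType) :=
  {S of Idealr R S & isMaximalIdealr R S}.

Section ResidueField.
Variables (R : comNzRingType) (M : maximal_idealr R).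

Definition residue_field := {ideal_quot M}.

HB.instance Definition _ := GRing.ComNzRing.on residue_field.

Definition residue (x : R) : residue_field := (\pi_{ideal_quot M} x)%qT.

HB.instance Definition _ := GRing.RMorphism.copy residue
  (\pi_{ideal_quot M} : R -> {ideal_quot M})%qT.

HB.instance Definition _ := GRing.ComNzRing_hasMulInverse.Build residue_field
  (@cmulVr residue_field) (@cunitP residue_field) (@cinv_out residue_field).

End ResidueField.
Section ResidueFieldTheory.
Variables (R : comNzRingType) (M : maximal_idealr R).

Lemma residue_eq0 (x : R) : (residue M x == 0) = (x \in M).
Proof.
rewrite -(rmorph0 (residue M)) -[in RHS](subr0 x).
by rewrite Quotient.idealrBE.
Qed.

Lemma residue_field_axiom : GRing.field_axiom (residue_field M).
Proof.
move=> x x_neq0; set a : R := (repr (x : {ideal_quot M}))%qT.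
have xE : x = residue M a by rewrite /residue reprK.
have aNM : a \notin M by rewrite -residue_eq0 -xE.
pose J : {pred R} := [pred z | `[< exists r m, m \in M /\ z = r * a + m >]].
have [/asboolP[r [m [mM ram]]] | J1] := boolP (1 \in J).
  apply/asboolP; exists (residue M r); rewrite xE -rmorphM.
  have /eqP rm0 : residue M m == 0 by rewrite residue_eq0.
  by rewrite -[LHS]addr0 -rm0 -rmorphD -ram rmorph1.
have J_ideal : idealr_closed J.
  split=> //; first by apply/asboolP; exists 0, 0; rewrite rpred0 mul0r addr0.
  move=> b _ _ /asboolP[r [m [mM ->]]] /asboolP[s [n [nM ->]]].
  apply/asboolP; exists (b * r + s), (b * m + n).
  split; first by rewrite rpredD ?idealMr.
  by rewrite mulrDr mulrDl mulrA addrACA.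
pose JI : idealr R := HB.pack J (isIdealr.Build R J J_ideal).
have sMJ : {subset M <= JI}.
  by move=> z zM; apply/asboolP; exists 0, z; rewrite mul0r add0r.
case/negP: aNM; apply: (@maximal_idealr_subproof _ M JI sMJ).
by apply/asboolP; exists 1, 0; rewrite rpred0 mul1r addr0.
Qed.

HB.instance Definition _ :=
  GRing.ComUnitRing_isField.Build (residue_field M) residue_field_axiom.

End ResidueFieldTheory.

Section Pullback.
Variables (R : comNzRingType) (M : maximal_idealr R).
Variable D : subringClosed (residue_field M).

Definition pullback : {pred R} := [pred x | residue M x \in D].

Lemma pullback_subring_closed : subring_closed pullback.
Proof.
split=> [|x y|x y]; rewrite !inE /= ?rmorph1 ?rpred1 // => xD yD.
  by rewrite rmorphB rpredB.
by rewrite rmorphM rpredM.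
Qed.

HB.instance Definition _ :=
  GRing.isSubringClosed.Build R pullback pullback_subring_closed.

End Pullback.

Section TPotent.
Variable A : idomainType.
Implicit Types (I N : set A) (J : set {fraction A}).

Local Notation tofrac := (@FracField.tofrac A).

Definition ideal I : Prop :=
  [/\ I 0, forall x y, I x -> I y -> I (x + y) & forall a x, I x -> I (a * x)].

(* An ideal of [A], viewed as a fractional ideal. *)
Definition frac_ideal I : set {fraction A} := tofrac @` I.

Definition frac_span (s : seq {fraction A}) : set {fraction A} :=
  [set x | exists a : nat -> A, x = \sum_(i < size s) tofrac (a i) * s`_i].

Definition fin_gen J : Prop := exists s, J = frac_span s.

Definition frac_inv J : set {fraction A} :=
  [set x | forall y, J y -> range tofrac (x * y)].

Definition v_closure J : set {fraction A} := frac_inv (frac_inv J).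

Definition t_closure J : set {fraction A} :=
  \bigcup_(L in [set L | [/\ fin_gen L, L <> [set 0] & L `<=` J]]) v_closure L.

Definition t_ideal I : Prop :=
  [/\ ideal I, I <> [set 0] & t_closure (frac_ideal I) = frac_ideal I].

Definition proper_t_ideal I : Prop := t_ideal I /\ I <> setT.

Definition maximal_t_ideal N : Prop :=
  proper_t_ideal N /\ forall I, proper_t_ideal I -> N `<=` I -> I = N.

Definition t_rigid I : Prop :=
  [/\ ideal I, fin_gen (frac_ideal I), I <> [set 0] &
      exists! N, maximal_t_ideal N /\ I `<=` N].

Definition t_potent_ideal N : Prop :=
  maximal_t_ideal N /\ exists I, t_rigid I /\ I `<=` N.

Definition t_potent_domain : Prop :=
  forall N, maximal_t_ideal N -> t_potent_ideal N.

End TPotent.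

Arguments t_potent_domain : clear implicits.

(* Main.v *)
Require Import Defs.
From mathcomp Require Import all_boot all_order all_algebra.
From mathcomp Require Import boolp classical_sets.
From mathcomp Require Import ring.

Local Open Scope ring_scope.
Local Open Scope classical_set_scope.

Import GRing.Theory.

(** Write R for the pullback of D, phi : T -> k for the residue map, and
    psi : R -> D for its restriction; M is an ideal of both R and T. The proof
    lists the maximal t-ideals of R, finds each of them in D or in T, and then
    transports, for each kind, a finite set of generators that isolates it.

    Three reductions make everything elementary. A fraction a / b lies in the
    inverse of the ideal generated by s exactly when b divides a * c for every
    c in s, so t-ideals are described by divisibility inside the domain
    ([v_hull], [t_idealP]). A maximal t-ideal N is t-potent exactly when some
    finite subset of N lies in no other maximal t-ideal ([t_potent_idealP]).
    Maximal t-ideals exist above every proper t-ideal and are prime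
    ([exists_maximal_t_ideal], [maximal_t_ideal_prime]).

    A maximal t-ideal N of R is of one of three kinds ([maximal_cases]).
    - N strictly contains M. If e in R lies outside M then e and M generate the
      unit ideal of T, so a fraction that carries N into R already lies in T;
      hence v-closures in R and in D correspond through psi, and N is the
      preimage of a maximal t-ideal of D.
    - N = M. As D is not the whole of k, an element x of R with x T inside R
      must lie in M, which makes a nonzero M a t-ideal of R. It is maximal
      exactly when D is a field.
    - N and M are incomparable. Multiplication by an element of M outside N
      carries T into R, so divisibility in T and in R differ only by a factor
      outside N, and N is the trace on R of a unique maximal t-ideal Q of T
      that is not contained in M.

    An isolating finite set passes from one ring to the other once it is
    enlarged to exclude the ideals of the other kinds: elements e and m with
    u * e + m = 1 and m in M exclude the third kind, an element outside M
    excludes M itself, and an element q of Q for which 1 - q lies in M excludes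
    every ideal that contains M. For N = M either M is a t-ideal of T, and its isolating
    set in T works in R as well, or some finite subset of M has 1 in its
    v-closure in T, and that subset isolates M in R. *)

(** * Divisibility form of the v- and t-operations *)

Section StarClosure.
Context {A : idomainType}.
Implicit Types (I N : set A) (s : seq A) (x y : A).

Local Notation tofrac := (@FracField.tofrac A).

(** The v-closure of the ideal generated by [s], with a / b running over the
    inverse of that ideal. *)
Definition v_hull s : set A :=
  [set x | forall a b, b != 0 ->
     (forall c, c \in s -> exists r, a * c = b * r) -> exists r, a * x = b * r].

Lemma mem_v_hull s x : x \in s -> v_hull s x.
Proof. by move=> xs a b _; apply. Qed.

(** Idempotence and monotonicity of the v-operation in one statement. *)
Lemma v_hull_trans s s' :
  (forall c, c \in s -> v_hull s' c) -> v_hull s `<=` v_hull s'.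
Proof.
move=> ss' x sx a b b0 abs'; apply: sx => // c /ss'; exact.
Qed.

Lemma v_hull_sub s s' : {subset s <= s'} -> v_hull s `<=` v_hull s'.
Proof. by move=> ss'; apply: v_hull_trans => c /ss'/mem_v_hull. Qed.

Lemma v_hullD s x y : v_hull s x -> v_hull s y -> v_hull s (x + y).
Proof.
move=> sx sy a b b0 abs; have [r xr] := sx _ _ b0 abs.
have [q yq] := sy _ _ b0 abs; exists (r + q).
by rewrite !mulrDr xr yq.
Qed.

Lemma v_hullMl s a x : v_hull s x -> v_hull s (a * x).
Proof.
move=> sx c b b0 cbs; have [r xr] := sx _ _ b0 cbs.
by exists (a * r); rewrite mulrCA xr mulrCA.
Qed.

Lemma v_hull_scale s a x : v_hull s x -> v_hull [seq a * c | c <- s] (a * x).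
Proof.
move=> sx c b b0 cbs; have [|r] := sx (c * a) b b0; last first.
  by rewrite -mulrA => e; exists r.
by move=> d ds; rewrite -mulrA; apply: cbs; apply: map_f.
Qed.

Lemma frac_divE (u : {fraction A}) :
  exists a b, b != 0 /\ u = tofrac a / tofrac b.
Proof.
set q := repr u; exists (\n_q)%R, (\d_q)%R.
have q0 : \d_q != 0 by exact: denom_ratioP.
have d0 : tofrac \d_q != 0 by rewrite tofrac_eq0.
split=> //; apply: (mulIf d0); rewrite mulfVK // -[u]reprK -/q.
unlock FracField.tofrac; rewrite -[LHS]FracField.pi_mul.
apply/eqmodP; rewrite /= FracField.equivfE /FracField.mulf.
by rewrite !numden_Ratio ?mulr1 ?mulf_neq0 ?oner_neq0 // mulrC.
Qed.

Lemma tofrac_inj : injective tofrac.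
Proof. by move=> x y /eqP; rewrite tofrac_eq => /eqP. Qed.

Lemma range_tofrac_div (a b c : A) : b != 0 ->
  range tofrac (tofrac a / tofrac b * tofrac c) <-> exists r, a * c = b * r.
Proof.
move=> b0; have Fb0 : tofrac b != 0 by rewrite tofrac_eq0.
split=> [[r _ e]|[r e]]; exists r => //.
  by apply: tofrac_inj; rewrite !tofracM e mulrA mulrCA divff // mulr1 mulrC.
by rewrite mulrAC -tofracM e tofracM mulrAC divff // mul1r.
Qed.

Lemma frac_span_gen (s : seq {fraction A}) u : u \in s -> frac_span s u.
Proof.
move=> us; have ks : (index u s < size s)%N by rewrite index_mem.
exists (fun i => (i == index u s)%:R); rewrite (bigD1 (Ordinal ks)) //=.
rewrite eqxx tofrac1 mul1r nth_index // big1 ?addr0 // => i.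
by rewrite -val_eqE /= => /negPf ->; rewrite tofrac0 mul0r.
Qed.

Lemma frac_span_map_tofrac s x : frac_span (map tofrac s) (tofrac x) <->
  exists a : nat -> A, x = \sum_(i < size s) a i * s`_i.
Proof.
have E (a : nat -> A) : tofrac (\sum_(i < size s) a i * s`_i) =
    \sum_(i < size (map tofrac s)) tofrac (a i) * (map tofrac s)`_i.
  rewrite rmorph_sum size_map; apply: eq_bigr => i _.
  by rewrite rmorphM (nth_map 0).
split=> [[a e]|[a ->]]; exists a => //.
by apply: tofrac_inj; rewrite E.
Qed.

(** The elements of the v-closure are not fractions: 1 belongs to the inverse
    of an integral ideal. *)
Lemma v_closure_tofrac s u : v_closure (frac_span (map tofrac s)) u <->
  exists2 x, v_hull s x & u = tofrac x.
Proof.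
have invE a b : b != 0 ->
    frac_inv (frac_span (map tofrac s)) (tofrac a / tofrac b) <->
    forall c, c \in s -> exists r, a * c = b * r.
  move=> b0; split=> [inv c cs|abs _ [f ->]].
    by apply/range_tofrac_div => //; apply: inv; apply/frac_span_gen/map_f.
  rewrite mulr_sumr; apply: (big_ind (range tofrac)).
  - by exists 0; rewrite ?tofrac0.
  - by move=> _ _ [x _ <-] [y _ <-]; exists (x + y); rewrite ?tofracD.
  move=> [i /=]; rewrite size_map => ks _; rewrite (nth_map 0) // mulrCA.
  have /range_tofrac_div-/(_ b0)[r _ <-] := abs _ (mem_nth 0 ks).
  by exists (f i * r); rewrite ?tofracM.
split=> [cu|[x sx ->] v]; last first.
  have [a [b [b0 ->]]] := frac_divE v.
  move=> /(invE _ _ b0)/(sx _ _ b0)/(range_tofrac_div _ _ _ b0).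
  by rewrite mulrC.
have [x _ xu] : range tofrac u.
  rewrite -[u]mulr1; apply: cu; rewrite -[1]divr1 -tofrac1.
  apply/invE; rewrite ?oner_neq0 // => c _; by exists c.
exists x => // a b b0 /(invE _ _ b0)/cu; rewrite -xu mulrC.
by move/(range_tofrac_div _ _ _ b0).
Qed.

Lemma seq_tofrac I (s : seq {fraction A}) :
  (forall u, u \in s -> frac_ideal I u) ->
  exists2 s', s = map tofrac s' & forall c, c \in s' -> I c.
Proof.
elim: s => [|u s IHs] sI; first by exists [::].
have [|s' -> s'I] := IHs; first by move=> v vs; apply: sI; rewrite inE vs orbT.
have [x Ix <-] := sI _ (mem_head _ _); exists (x :: s') => // c.
by rewrite inE => /predU1P[->|/s'I].
Qed.

Lemma ideal_sum I s (a : nat -> A) : ideal I ->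
  (forall c, c \in s -> I c) -> I (\sum_(i < size s) a i * s`_i).
Proof.
move=> [I0 ID IM] sI; apply: (big_ind I) => // i _.
by apply/IM/sI/mem_nth.
Qed.

Lemma frac_span_sub I s : ideal I -> (forall c, c \in s -> I c) ->
  frac_span (map tofrac s) `<=` frac_ideal I.
Proof.
move=> idI sI _ [a ->]; exists (\sum_(i < size s) a i * s`_i).
  exact: (ideal_sum I s).
rewrite rmorph_sum size_map; apply: eq_bigr => i _.
by rewrite rmorphM (nth_map 0).
Qed.

Lemma frac_span_neq0 s n : n \in s -> n != 0 ->
  frac_span (map tofrac s) <> [set 0].
Proof.
move=> ns n0 L0; have : frac_span (map tofrac s) (tofrac n).
  by apply/frac_span_gen/map_f.
by rewrite L0 => /eqP; rewrite tofrac_eq0 (negPf n0).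
Qed.

Lemma ideal_neq0P I : ideal I -> I <> [set 0] <-> exists2 n, I n & n != 0.
Proof.
case=> I0 _ _; split=> [nI0|[n In n0] I_0].
  apply: contrapT => nI; apply: nI0; apply/seteqP; split=> [x Ix|_ -> //] /=.
  by apply/eqP; apply: contrapT => /negP x0; apply: nI; exists x.
by move: In n0; rewrite I_0 => -> /eqP.
Qed.

(** The t-operation takes only nonzero finitely generated subideals into
    account, but here [s] may consist of zeros: adjoining a fixed nonzero
    element of [I] to [s] only enlarges its v-closure. *)
Lemma t_idealP I : t_ideal I <-> [/\ ideal I, exists2 n, I n & n != 0 &
  forall s, (forall c, c \in s -> I c) -> v_hull s `<=` I].
Proof.
split=> [[idI nzI tI]|[idI nzI tI]].
  have /(ideal_neq0P _ idI)[n In n0] := nzI; split=> //; first by exists n.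
  move=> s sI x sx; suff: frac_ideal I (tofrac x) by case=> y Iy /tofrac_inj <-.
  have nsI : forall c, c \in n :: s -> I c.
    by move=> c; rewrite inE => /predU1P[->|/sI].
  rewrite -tI; exists (frac_span (map tofrac (n :: s))); last first.
    apply/v_closure_tofrac; exists x => //; apply: v_hull_sub sx => c cs.
    by rewrite inE cs orbT.
  split; [by exists (map tofrac (n :: s)) | | exact: frac_span_sub].
  exact: frac_span_neq0 (mem_head _ _) n0.
split=> //; first exact/ideal_neq0P.
apply/seteqP; split=> [u [_ [[s ->] _ sI]]|_ [x Ix <-]].
  have [s' -> s'I] : exists2 s', s = map tofrac s' & forall c, c \in s' -> I c.
    by apply: seq_tofrac => v vs; apply/sI/frac_span_gen.
  by move=> /v_closure_tofrac[x /(tI _ s'I) Ix ->]; exists x.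
have [n In n0] := nzI.
have xnI : forall c, c \in [:: x; n] -> I c.
  by move=> c; rewrite !inE => /orP[/eqP ->|/eqP ->].
exists (frac_span (map tofrac [:: x; n])); last first.
  by apply/v_closure_tofrac; exists x => //; apply/mem_v_hull/mem_head.
split; [by exists (map tofrac [:: x; n]) | | exact: frac_span_sub].
by apply: frac_span_neq0 n0; rewrite !inE eqxx orbT.
Qed.
End StarClosure.

(** * Maximal t-ideals *)

Section MaximalTIdeals.
Context {A : idomainType}.
Implicit Types (I N : set A) (s : seq A) (x y : A).

Local Notation tofrac := (@FracField.tofrac A).

Lemma ideal_neqTP I : ideal I -> I <> setT <-> ~ I 1.
Proof.
case=> _ _ IM; split=> [nT I1|nI1 IT]; last by apply: nI1; rewrite IT.
by apply: nT; apply/seteqP; split=> // x _; rewrite -(mulr1 x); apply: IM.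
Qed.

Lemma proper_t_idealP I : proper_t_ideal I <-> t_ideal I /\ ~ I 1.
Proof.
by split=> -[tI nI]; split=> //; have [idI _ _] := tI;
  apply/(ideal_neqTP _ idI).
Qed.

Lemma chain_seq (F : set (set A)) s : total_on F subset -> F !=set0 ->
  (forall c, c \in s -> (\bigcup_(X in F) X) c) ->
  exists2 X, F X & forall c, c \in s -> X c.
Proof.
move=> totF [X0 FX0]; elim: s => [|c s IHs] sF; first by exists X0.
have [|X FX sX] := IHs; first by move=> d ds; apply: sF; rewrite inE ds orbT.
have [Y FY Yc] := sF _ (mem_head _ _).
have [XY|YX] := totF _ _ FX FY; [exists Y => //|exists X => //] => d;
  rewrite inE => /predU1P[->|/sX] //; [exact: XY|exact: YX].
Qed.

(** The t-operation has finite character, so the union of a chain of proper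
    t-ideals is again one, and Zorn's lemma applies. *)
Lemma exists_maximal_t_ideal I : proper_t_ideal I ->
  exists2 N, maximal_t_ideal N & I `<=` N.
Proof.
move=> pI; pose P X := X = set0 \/ (I `<=` X /\ proper_t_ideal X).
(* [set0] is admitted in [P] because the empty chain has empty union. *)
have [|N [PN Nmax]] := @Zorn_bigcup A P.
  move=> F FP totF; have [[X FX X0]|F0] := pselect (exists2 X, F X & X <> set0).
    2: by left; apply/seteqP; split=> // x [X FX Xx]; case: F0;
      exists X => // X0; rewrite X0 in Xx.
  have FP' Y y : F Y -> Y y -> I `<=` Y /\ proper_t_ideal Y.
    by move=> /FP[-> //|].
  have [//|IX] := FP _ FX.
  have FXn : F !=set0 by exists X.
  right; split; first by move=> x Ix; exists X => //; apply: IX.1.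
  have [/t_idealP[[I0 _ _] [n In n0] _] _] := pI.
  apply/proper_t_idealP; split; last first.
    move=> [Y FY Y1]; have [_ /proper_t_idealP[_]] := FP' _ _ FY Y1; exact.
  have union s : (forall c, c \in s -> (\bigcup_(X in F) X) c) ->
      exists2 Y, F Y /\ t_ideal Y & forall c, c \in s -> Y c.
    (* 0 makes [Y] nonempty, hence a t-ideal, even when [s] is empty. *)
    move=> sF; have [|Y FY sY] := chain_seq F (0 :: s) totF FXn.
      move=> c; rewrite inE => /predU1P[->|/sF //].
      by exists X => //; apply/IX.1.
    exists Y; last by move=> c cs; apply: sY; rewrite inE cs orbT.
    by have [_ [tY _]] := FP' _ _ FY (sY _ (mem_head _ _)).
  apply/t_idealP; split; last first.
  - move=> s /union[Y [FY /t_idealP[_ _ tY]] sY] x /(tY _ sY) Yx.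
    by exists Y.
  - by exists n => //; exists X => //; apply: IX.1.
  split=> [|x y Fx Fy|a x Fx].
  - by exists X => //; apply: IX.1.
  - have [c|Y [FY /t_idealP[[_ YD _] _ _]] sY] := union [:: x; y].
      by rewrite !inE => /orP[]/eqP->.
    by exists Y => //; apply: YD; apply: sY; rewrite !inE eqxx ?orbT.
  - have [Y FY Yx] := Fx; exists Y => //.
    by have [_ [/t_idealP[[_ _ YM] _ _] _]] := FP' _ _ FY Yx; apply: YM.
have N0 : N <> set0.
  move=> N0; apply: (Nmax I); last by right; split.
  have [[[I0 _ _] _ _] _] := pI.
  by rewrite N0; split=> [x []|I_0]; apply: (I_0 0).
case: PN => [//|[IN pN]]; exists N => //; split=> // J pJ NJ.
apply: contrapT => JN; apply: (Nmax J).
  by split=> // JN'; apply: JN; apply/seteqP.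
by right; split=> //; apply: subset_trans NJ.
Qed.

(** The t-closure of [I + (a)]. *)
Lemma t_ideal_adjoin I a : t_ideal I ->
  t_ideal [set x | exists2 s, forall c, c \in s -> I c & v_hull (a :: s) x].
Proof.
move=> /t_idealP[[I0 ID IM] [n In n0] tI].
have catI s s' : (forall c, c \in s -> I c) -> (forall c, c \in s' -> I c) ->
    forall c, c \in s ++ s' -> I c.
  by move=> sI s'I c; rewrite mem_cat => /orP[/sI|/s'I].
have adjS s s' : {subset s <= s'} -> v_hull (a :: s) `<=` v_hull (a :: s').
  move=> ss'; apply: v_hull_sub => c; rewrite !inE.
  by case/predU1P=> [->|/ss' ->]; rewrite ?eqxx ?orbT.
apply/t_idealP; split.
- split=> [|x y [s sI sx] [s' s'I s'y]|b x [s sI sx]].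
  + exists [:: 0]; first by move=> c /[!inE] /eqP->.
    by apply: mem_v_hull; rewrite !inE eqxx orbT.
  + exists (s ++ s'); first exact: catI.
    apply: v_hullD; [apply: adjS sx|apply: adjS s'y] => c cs;
    by rewrite mem_cat cs ?orbT.
  + by exists s => //; apply: v_hullMl.
- exists n => //; exists [:: n]; first by move=> c /[!inE] /eqP->.
  by apply: mem_v_hull; rewrite !inE eqxx orbT.
move=> s sIa x sx.
have [S SI sS] : exists2 S : seq A, forall c, c \in S -> I c &
    forall c, c \in s -> v_hull (a :: S) c.
  elim: s sIa {sx} => [|c s IHs] sIa; first by exists [::].
  have [|S SI sS] := IHs; first by move=> d ds; apply: sIa; rewrite inE ds orbT.
  have [S' S'I S'c] := sIa _ (mem_head _ _).
  exists (S' ++ S); first exact: catI.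
  move=> d; rewrite inE => /predU1P[->|/sS Sd].
    by apply: adjS S'c => e eS; rewrite mem_cat eS.
  by apply: adjS Sd => e eS; rewrite mem_cat eS orbT.
by exists S => //; apply: v_hull_trans sx.
Qed.

(** If [x] is not in [N], maximality puts 1 in the v-closure of [x :: s] for
    some [s] in [N]; multiplying by [y] puts [y] in the v-closure of the
    multiples by [y] of [x] and of [s], which all lie in [N]. *)
Lemma maximal_t_ideal_prime N x y : maximal_t_ideal N ->
  N (x * y) -> N x \/ N y.
Proof.
move=> [pN Nmax] Nxy; have [tN N1] := pN.
have /t_idealP[[N0 ND NM] _ Nv] := tN.
set I := [set z |
  exists2 s : seq A, forall c, c \in s -> N c & v_hull (x :: s) z].
have tI : t_ideal I by exact: t_ideal_adjoin.
have NI : N `<=` I.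
  move=> z Nz; exists [:: z]; first by move=> c /[!inE]/eqP->.
  by apply: mem_v_hull; rewrite !inE eqxx orbT.
have Ix : I x by exists [::] => //; apply/mem_v_hull/mem_head.
have [[s sN /(v_hull_scale _ y) s1]|nI1] := pselect (I 1).
  right; rewrite -(mulr1 y); apply: Nv s1 => _ /mapP[c cs ->].
  by move: cs; rewrite inE => /predU1P[->|/sN]; [rewrite mulrC | exact: NM].
by left; rewrite -(Nmax I) //; apply/proper_t_idealP.
Qed.

(** A maximal t-ideal contains the ideal generated by [s] as soon as it contains
    [s], so t-rigid ideals may be replaced by finite sets. *)
Lemma t_potent_idealP N : t_potent_ideal N <-> maximal_t_ideal N /\
  exists2 s : seq A, forall c, c \in s -> N c &
    forall N', maximal_t_ideal N' -> (forall c, c \in s -> N' c) -> N' = N.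
Proof.
split=> [[mN [I [[idI [S IS] _ [N0 [[_ _] N0u]]] IN]]]|[mN [s sN sNu]]].
  have [|s Ss sI] := seq_tofrac I S.
    by move=> u uS; rewrite IS; apply: frac_span_gen.
  split=> //; exists s => [c /sI/IN //|N' mN' sN'].
  have IN' : I `<=` N'.
    move=> x Ix; have : frac_ideal I (tofrac x) by exists x.
    have [[/t_idealP[idN' _ _] _] _] := mN'.
    rewrite IS Ss => /(frac_span_sub _ _ idN' sN')[y N'y /tofrac_inj <- //].
  by rewrite -(N0u N) // -(N0u N').
split=> //; have [[/t_idealP[idN [n Nn n0] _] _] _] := mN.
have nsN c : c \in n :: s -> N c by rewrite inE => /predU1P[->|/sN].
pose L := frac_span (map tofrac (n :: s)).
have LN := frac_span_sub _ _ idN nsN : L `<=` _.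
exists [set x | L (tofrac x)]; split; last first.
  by move=> x /LN[y Ny /tofrac_inj <-].
have idL : ideal [set x | L (tofrac x)].
  split=> [|x y /frac_span_map_tofrac[a ->] /frac_span_map_tofrac[b ->]|
    a x /frac_span_map_tofrac[b ->]]; apply/frac_span_map_tofrac.
  - by exists (fun=> 0); rewrite big1 // => i _; rewrite mul0r.
  - exists (fun i => a i + b i); rewrite -big_split; apply: eq_bigr => i _.
    by rewrite mulrDl.
  - exists (fun i => a * b i); rewrite mulr_sumr; apply: eq_bigr => i _.
    by rewrite mulrA.
have gL c : c \in n :: s -> L (tofrac c).
  by move=> cs; apply/frac_span_gen/map_f.
split=> //.
- exists (map tofrac (n :: s)); apply/seteqP; split=> [_ [x Lx <-] //|u Lu].
  by have [x _ xu] := LN _ Lu; exists x; rewrite /= ?xu.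
- by apply/(ideal_neq0P _ idL); exists n => //; apply/gL/mem_head.
exists N; split; first by split=> // x /LN[y Ny /tofrac_inj <-].
move=> N' [mN' LN']; apply/esym/sNu => // c cs; apply/LN'/gL.
by rewrite inE cs orbT.
Qed.

End MaximalTIdeals.

(** * Fields and principal ideals *)

Section TIdealsOfDomains.
Context {A : idomainType}.
Implicit Types (I : set A).

Lemma field_no_proper_t_ideal I : GRing.field_axiom A -> ~ proper_t_ideal I.
Proof.
move=> fA /proper_t_idealP[/t_idealP[[_ _ IM] [n In n0] _] nI1].
by apply: nI1; rewrite -(mulVr (fA _ n0)); apply: IM.
Qed.

Lemma t_ideal_principal (a : A) : a != 0 ->
  t_ideal [set x | exists r, x = a * r].
Proof.
move=> a0; apply/t_idealP; split.
- split=> [|x y [r ->] [q ->]|b x [r ->]].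
  + by exists 0; rewrite mulr0.
  + by exists (r + q); rewrite mulrDr.
  + by exists (b * r); rewrite mulrCA.
- by exists a => //; exists 1; rewrite mulr1.
move=> s sa x sx; rewrite /= -[x]mul1r; apply: sx => // c /sa[r ->].
by exists r; rewrite mul1r.
Qed.

End TIdealsOfDomains.

(** * The pullback square *)

Section SubdomainVal.
Context {A : idomainType} {S : subringClosed A}.
Implicit Types x y : subdomain S.

Lemma subdomain_val_eq0 x : (val x == 0) = (x == 0).
Proof. by rewrite -(rmorph0 (val : subdomain S -> A)) val_eqE. Qed.

Lemma subdomain_valD x y : val (x + y) = val x + val y.
Proof. exact: rmorphD. Qed.

Lemma subdomain_valM x y : val (x * y) = val x * val y.
Proof. exact: rmorphM. Qed.

End SubdomainVal.

Section PullbackTIdeals.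
Context {T : idomainType} {M : maximal_idealr T}.
Context {D : subringClosed (residue_field M)}.

Local Notation R := (subdomain (pullback D)).
Local Notation DD := (subdomain D).
Local Notation phi := (residue M).

Implicit Types (m t : T) (x : R) (d : DD).

Lemma residue_surj (y : residue_field M) : exists t, phi t = y.
Proof.
by exists (repr (y : {ideal_quot M}))%qT; rewrite /residue reprK.
Qed.

Lemma residueM : {morph phi : t u / t * u}.
Proof. exact: rmorphM. Qed.

Lemma residue_M m : m \in M -> phi m = 0.
Proof. by rewrite -residue_eq0 => /eqP. Qed.

(** [M] is maximal, so its complement consists of units modulo [M]. *)
Lemma comaximal_M t : t \notin M -> exists u m, m \in M /\ u * t + m = 1.
Proof.
rewrite -residue_eq0 => t0; have [u ut] := residue_surj (phi t)^-1.
exists u, (1 - u * t); split; last by rewrite addrC subrK.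
by rewrite -residue_eq0 rmorphB rmorph1 /= residueM ut mulVf // subrr.
Qed.

Lemma M_pullback m : m \in M -> m \in pullback D.
Proof. by move=> mM; rewrite !inE residue_M // rpred0. Qed.

(** Elements of [T] outside the pullback get the junk value 0. *)
Definition to_pullback t : R := insubd 0 t.

Lemma to_pullbackK t : t \in pullback D -> val (to_pullback t) = t.
Proof. by move=> tR; rewrite /to_pullback insubdK. Qed.

Lemma to_pullback_MK m : m \in M -> val (to_pullback m) = m.
Proof. by move/M_pullback/to_pullbackK. Qed.

Lemma dvd_pullback (a x b : R) t : t \in pullback D ->
  val a * val x = val b * t -> exists r, a * x = b * r.
Proof.
move=> tR e; exists (to_pullback t); apply: val_inj.
by rewrite !subdomain_valM e to_pullbackK.
Qed.

Definition pullback_residue x : DD := Subdomain (valP x : phi (val x) \in D).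

Local Notation psi := pullback_residue.

Lemma val_psi x : val (psi x) = phi (val x). Proof. by []. Qed.

Lemma psi1 : psi 1 = 1.
Proof. by apply: val_inj; rewrite val_psi !rmorph1. Qed.

Lemma psi0 : psi 0 = 0.
Proof. by apply: val_inj; rewrite val_psi !rmorph0. Qed.

Lemma psiD : {morph psi : x y / x + y}.
Proof. by move=> x y; apply: val_inj; rewrite !(val_psi, rmorphD). Qed.

Lemma psiM : {morph psi : x y / x * y}.
Proof. by move=> x y; apply: val_inj; rewrite !(val_psi, rmorphM). Qed.

Lemma psiB : {morph psi : x y / x - y}.
Proof. by move=> x y; apply: val_inj; rewrite !(val_psi, rmorphB). Qed.

Lemma psi_surj d : exists x, psi x = d.
Proof.
have [t td] := residue_surj (val d).
have tR : t \in pullback D by rewrite !inE td; apply: valP.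
by exists (to_pullback t); apply: val_inj; rewrite val_psi to_pullbackK.
Qed.

Lemma psi_eq0 x : (psi x == 0) = (val x \in M).
Proof. by rewrite -val_eqE val_psi rmorph0 residue_eq0. Qed.

Definition M_in_T : set T := [set t | t \in M].
Definition M_in_R : set R := [set x | val x \in M].

Lemma ideal_M_one (I : set T) :
  ideal I -> M_in_T `<=` I -> ~ (I `<=` M_in_T) -> I 1.
Proof.
move=> [_ ID IM] MI /existsNP[t /not_implyP[It /negP tM]].
have [u [m [mM <-]]] := comaximal_M t tM.
by apply: ID; [apply: IM | apply: MI].
Qed.

Lemma M_in_RE x : M_in_R x = (val x \in M).
Proof. by []. Qed.

Lemma ideal_M_in_R : ideal M_in_R.
Proof.
split=> [|x y|a x]; rewrite ?M_in_RE ?rmorph0 ?rpred0 //.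
  by rewrite subdomain_valD => ? ?; rewrite rpredD.
by rewrite subdomain_valM; apply: idealMr.
Qed.

(** A fraction a / b of D has a residue in [k], which lifts to some [y] in [T];
    if a / b carries [map psi s] into D then [y] carries [s] into the
    pullback. *)
Lemma v_hull_psi (s : seq R) x : v_hull s x -> v_hull (map psi s) (psi x).
Proof.
move=> sx a b b0 abs.
have [y ye] := residue_surj (val a / val b).
have b0' : val b != 0 by rewrite subdomain_val_eq0.
have [b' b'b] := psi_surj b.
have yb : phi (y * val b') = val a.
  by rewrite residueM -val_psi b'b ye divfK.
(* [y] is the fraction y * b' / b' of the pullback. *)
have ybR : y * val b' \in pullback D by rewrite !inE yb; apply: valP.
have b'0 : b' != 0 by apply: contraNneq b0 => e; rewrite -b'b e psi0.
have [c cs|r xr] := sx (to_pullback (y * val b')) b' b'0.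
  have [r cr] := abs (psi c) (map_f _ cs).
  apply: (@dvd_pullback _ _ _ (y * val c)).
    2: by rewrite to_pullbackK //; ring.
  rewrite !inE residueM ye -val_psi mulrAC -subdomain_valM cr.
  rewrite subdomain_valM mulrAC divff //.
  by rewrite mul1r; apply: valP.
exists (psi r); rewrite -b'b -psiM -xr psiM; congr (_ * _).
by apply: val_inj; rewrite val_psi to_pullbackK.
Qed.

Lemma t_ideal_psi_preimage (P : set DD) : t_ideal P -> t_ideal (psi @^-1` P).
Proof.
move=> /t_idealP[[P0 PD PM] [d Pd d0] tP]; apply/t_idealP; split.
- split=> [|x y Px Py|a x Px]; rewrite /preimage /= ?psi0 ?psiD ?psiM //.
    exact: PD.
  exact: PM.
- have [x xd] := psi_surj d; exists x; first by rewrite /preimage /= xd.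
  by apply: contraNneq d0 => x0; rewrite -xd x0 psi0.
move=> s sP x /v_hull_psi sx; apply: (tP (map psi s)) sx.
by move=> _ /mapP[c /sP Pc ->].
Qed.

Lemma psi_imageK (I : set R) :
  ideal I -> M_in_R `<=` I -> psi @^-1` (psi @` I) = I.
Proof.
move=> [_ ID _] MI; apply/seteqP; split=> x /=.
  2: by exists x.
case=> y Iy yx.
rewrite -(subrK y x); apply: ID => //; apply: MI.
by rewrite M_in_RE -psi_eq0 psiB yx subrr.
Qed.

(** For [e] in [I] outside [M], choose [u * e + m = 1] with [m] in [M]. A
    fraction of the pullback that carries both [e] and [m] into it lies in [T],
    so its residue is defined and carries [s] into D whenever the fraction
    carries the lifts of [s] into the pullback. *)
Lemma t_ideal_psi_image (I : set R) : t_ideal I -> M_in_R `<=` I ->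
  ~ (I `<=` M_in_R) -> t_ideal (psi @` I).
Proof.
move=> /t_idealP[idI nzI tI] MI /existsNP[e /not_implyP[Ie /negP eM]].
have [I0 ID IM] := idI.
apply/t_idealP; split.
- split=> [|_ _ [x Ix <-] [y Iy <-]|d _ [x Ix <-]].
  + by exists 0; rewrite ?psi0.
  + by exists (x + y); rewrite ?psiD //; apply: ID.
  + by have [a <-] := psi_surj d; exists (a * x); rewrite ?psiM //; apply: IM.
- by exists (psi e); [exists e | rewrite psi_eq0].
move=> s sI d sd; have [x xd] := psi_surj d; exists x => //.
have [u [m [mM ue]]] := comaximal_M (val e) eM.
have [g gK] := choice psi_surj.
apply: (tI [:: e, to_pullback m & map g s]).
  move=> c; rewrite !inE => /or3P[/eqP->//|/eqP->|/mapP[y /sI Iy ->]].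
    by apply: MI; rewrite M_in_RE to_pullback_MK.
  by rewrite -(psi_imageK I) // /preimage /= gK.
move=> a b b0 abs.
have vb0 : val b != 0 by rewrite subdomain_val_eq0.
have [r1 er1] := abs e (mem_head _ _).
have [r2 er2] : exists r, a * to_pullback m = b * r.
  by apply: abs; rewrite !inE eqxx orbT.
(* the quotient a / b lies in T *)
pose y := u * val r1 + val r2.
have ay : val a = val b * y.
  move: (congr1 val er1) (congr1 val er2).
  rewrite !subdomain_valM to_pullback_MK // => E1 E2.
  rewrite -[LHS]mulr1 -ue mulrDr mulrCA E1 E2 /y; ring.
have ye c : (exists r, a * c = b * r) -> y * val c \in pullback D.
  move=> [r cr]; suff -> : y * val c = val r by apply: valP.
  by apply: (mulfI vb0); rewrite mulrA -ay -!subdomain_valM cr.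
have ye_R : y * val e \in pullback D by apply: ye; exists r1.
have ye_phi : val (psi (to_pullback (y * val e))) = phi y * phi (val e).
  by rewrite val_psi to_pullbackK // residueM.
(* The residue of [y], as a fraction of D with denominator [psi e]. *)
have [||r dr] := sd (psi (to_pullback (y * val e))) (psi e).
- by rewrite psi_eq0.
- move=> c cs; have /ye cR : exists r, a * g c = b * r.
    by apply: abs; rewrite !inE map_f ?orbT.
  exists (psi (to_pullback (y * val (g c)))); apply: val_inj.
  rewrite !subdomain_valM ye_phi !val_psi to_pullbackK // residueM.
  by rewrite -{1}(gK c) val_psi; ring.
apply: (@dvd_pullback _ _ _ (y * val x)); last by rewrite ay; ring.
rewrite !inE residueM -val_psi xd.
suff -> : phi y * val d = val r by apply: valP.
have e0 : phi (val e) != 0 by rewrite residue_eq0.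
apply: (mulfI e0); rewrite mulrA [_ * phi y]mulrC -ye_phi.
by rewrite -!subdomain_valM dr.
Qed.

End PullbackTIdeals.

(** * The maximal t-ideals of the pullback *)

Section PullbackMaximal.
Context {T : idomainType} {M : maximal_idealr T}.
Context {D : subringClosed (residue_field M)}.

Local Notation R := (subdomain (pullback D)).
Local Notation DD := (subdomain D).
Local Notation phi := (residue M).
Local Notation M_in_T := (@M_in_T T M).
Local Notation M_in_R := (@M_in_R T M D).
Local Notation psi := (@pullback_residue T M D).
Local Notation to_pullback := (@to_pullback T M D).

Implicit Types (m t : T) (x : R) (d : DD) (P : set DD) (Q : set T) (N : set R).

Lemma maximal_psi_preimage P :
  maximal_t_ideal P -> maximal_t_ideal (psi @^-1` P).
Proof.
move=> [/proper_t_idealP[tP P1] Pmax].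
have /t_idealP[[P0 _ _] [d Pd d0] _] := tP; have [e ed] := psi_surj d.
split.
  apply/proper_t_idealP; split; first exact: t_ideal_psi_preimage.
  by rewrite /preimage /= psi1.
move=> I /proper_t_idealP[tI I1] PI; have [idI _ _] := tI.
have MI : M_in_R `<=` I.
  move=> x; rewrite M_in_RE -psi_eq0 => /eqP x0.
  by apply: PI; rewrite /preimage /= x0.
have IM : ~ (I `<=` M_in_R).
  move=> IM; suff: M_in_R e by rewrite M_in_RE -psi_eq0 ed (negPf d0).
  by apply/IM/PI; rewrite /preimage /= ed.
have IK := psi_imageK I idI MI.
rewrite -{1}IK; congr (_ @^-1` _); apply: Pmax.
  apply/proper_t_idealP; split; first exact: t_ideal_psi_image.
  by rewrite -psi1 -[_ (psi 1)]/((psi @^-1` (psi @` I)) 1) IK.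
by move=> d' Pd'; have [x xd] := psi_surj d'; exists x => //; apply: PI;
   rewrite /preimage /= xd.
Qed.

Lemma maximal_above_M N :
  maximal_t_ideal N -> M_in_R `<=` N -> ~ (N `<=` M_in_R) ->
  exists2 P, maximal_t_ideal P & N = psi @^-1` P.
Proof.
move=> [/proper_t_idealP[tN N1] Nmax] MN NM; have [idN _ _] := tN.
have NK := psi_imageK N idN MN.
exists (psi @` N) => //; split.
  apply/proper_t_idealP; split; first exact: t_ideal_psi_image.
  by rewrite -psi1 -[_ (psi 1)]/((psi @^-1` (psi @` N)) 1) NK.
move=> Q /proper_t_idealP[tQ Q1] NQ.
rewrite -(Nmax (psi @^-1` Q)).
- apply/seteqP; split=> [d Qd|_ [x Qx <-] //].
  by have [x xd] := psi_surj d; exists x => //=; rewrite xd.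
- apply/proper_t_idealP; split; first exact: t_ideal_psi_preimage.
  by rewrite /preimage /= psi1.
by move=> x Nx; apply: NQ; exists x.
Qed.

Lemma one_notin_M_in_R : ~ M_in_R 1.
Proof. by rewrite M_in_RE rmorph1 idealr1. Qed.

(** The inverse of a finite subset of [M] contains [T], so an element [x] of its
    v-closure satisfies [x T] inside the pullback. If [x] were outside [M], its
    residue would be a unit and D would be all of [k]. *)
Lemma t_ideal_M_in_R m0 : (exists y : residue_field M, y \notin D) ->
  m0 \in M -> m0 != 0 -> t_ideal M_in_R.
Proof.
move=> [k kD] m0M m00; apply/t_idealP; split; first exact: ideal_M_in_R.
  exists (to_pullback m0);
  by rewrite ?M_in_RE -?subdomain_val_eq0 to_pullback_MK.
move=> s sM x sx.
(* [t] is the fraction t * m0 / m0 of the pullback. *)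
have xT t : t * val x \in pullback D.
  have m0t : t * m0 \in M by apply: idealMr.
  have [|c /sM cM|r xr] := sx (to_pullback (t * m0)) (to_pullback m0).
  - by rewrite -subdomain_val_eq0 to_pullback_MK.
  - apply: (@dvd_pullback _ _ _ _ _ _ (t * val c)).
      by apply/M_pullback/idealMr.
    by rewrite !to_pullback_MK //; ring.
  suff -> : t * val x = val r by apply: valP.
  apply: (mulfI m00); move: (congr1 val xr).
  rewrite !subdomain_valM !to_pullback_MK // => <-.
  ring.
apply: contrapT => /negP; rewrite -residue_eq0 => x0.
have [t tk] := residue_surj (k / phi (val x)).
by move: (xT t); rewrite !inE residueM tk divfK // (negPf kD).
Qed.

Lemma maximal_t_ideal_M_in_R : GRing.field_axiom DD -> t_ideal M_in_R ->
  maximal_t_ideal M_in_R.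
Proof.
move=> fD tM; split.
  by apply/proper_t_idealP; split=> //; apply: one_notin_M_in_R.
move=> I /proper_t_idealP[tI I1] MI; apply/seteqP; split=> //.
apply: contrapT => IM; have [idI _ _] := tI.
apply: (field_no_proper_t_ideal (psi @` I) fD).
apply/proper_t_idealP; split; first exact: t_ideal_psi_image.
by rewrite -psi1 -[_ (psi 1)]/((psi @^-1` (psi @` I)) 1) psi_imageK.
Qed.

(** A nonzero nonunit of D generates a proper t-ideal of D, whose preimage
    strictly contains [M]. *)
Lemma field_of_maximal_M_in_R : maximal_t_ideal M_in_R -> GRing.field_axiom DD.
Proof.
move=> [_ Mmax] d d0; apply: contrapT => dU.
have [e ed] := psi_surj d.
pose P : set DD := [set y | exists r, y = d * r].
suff /Mmax E : proper_t_ideal (psi @^-1` P).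
  have : M_in_R e.
    rewrite -E; last first.
      move=> x; rewrite M_in_RE -psi_eq0 => /eqP x0; exists 0.
      by rewrite x0 mulr0.
    by exists 1; rewrite mulr1.
  by rewrite M_in_RE -psi_eq0 ed (negPf d0).
apply/proper_t_idealP; split.
  exact/t_ideal_psi_preimage/t_ideal_principal.
rewrite /preimage /= psi1 => -[r dr]; apply: dU.
by apply/unitrP; exists r; rewrite mulrC -dr.
Qed.

(** Multiplying numerator and denominator by [m] turns a fraction of [T] into a
    fraction of the pullback; the extra factor [m] in the conclusion is what
    brings quotients in [T] back into the pullback. *)
Lemma v_hull_pullback_ext (s : seq R) x m : m \in M -> v_hull s x ->
  v_hull (map val s) (m * val x).
Proof.
move=> mM sx; have [->|m0] := eqVneq m 0.
  by move=> a b _ _; exists 0; rewrite mul0r !mulr0.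
move=> a b b0 abs.
(* (a / b) * m, with numerator and denominator in [M]. *)
have maM : a * m * m \in M by apply: idealMr.
have mbM : b * m \in M by apply: idealMr.
have [|c cs|r xr] := sx (to_pullback (a * m * m)) (to_pullback (b * m)).
- by rewrite -subdomain_val_eq0 to_pullback_MK // mulf_neq0.
- have [r cr] := abs (val c) (map_f _ cs).
  apply: (@dvd_pullback _ _ _ _ _ _ (r * m)).
    by apply/M_pullback/idealMr.
  rewrite !to_pullback_MK //; transitivity (b * r * (m * m)); last ring.
  by rewrite -cr; ring.
exists (val r); apply: (mulfI m0).
move: (congr1 val xr); rewrite !subdomain_valM !to_pullback_MK // => E.
transitivity (b * m * val r); last ring.
by rewrite -E; ring.
Qed.

(** One factor [m] moves the elements of [T] into the pullback, and the second
    one moves the quotient produced in [T] there. *)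
Lemma v_hull_pullback_contract (s : seq T) t m : m \in M -> v_hull s t ->
  v_hull [seq to_pullback (c * m) | c <- s] (to_pullback (t * m * m)).
Proof.
move=> mM st a b b0 abs.
have vb0 : val b != 0 by rewrite subdomain_val_eq0.
have [c cs|r tr] := st (val a * m) (val b) vb0.
  have [r cr] := abs _ (map_f _ cs); exists (val r).
  move: (congr1 val cr).
  by rewrite !subdomain_valM to_pullback_MK ?idealMr // => <-; ring.
apply: (@dvd_pullback _ _ _ _ _ _ (r * m)); first by apply/M_pullback/idealMr.
rewrite to_pullback_MK ?idealMr // [RHS]mulrA -tr; ring.
Qed.

(** A maximal t-ideal of [T] not inside [M] is comaximal with [M], and this is
    witnessed by elements of the pullback. *)
Lemma maximal_not_in_M Q : maximal_t_ideal Q -> ~ (Q `<=` M_in_T) ->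
  exists q m, [/\ Q (val q), ~ M_in_R q, m \in M, ~ Q m & val q + m = 1 :> T].
Proof.
move=> [/proper_t_idealP[tQ Q1] _] QM.
have /t_idealP[[_ QD QM'] _ _] := tQ.
have /existsNP[t /not_implyP[Qt /negP tM]] := QM.
have [u [m [mM utm]]] := comaximal_M t tM.
have utR : u * t \in pullback D.
  rewrite (_ : u * t = 1 - m); last by rewrite -utm addrK.
  by rewrite rpredB ?rpred1 // M_pullback.
exists (to_pullback (u * t)), m; rewrite M_in_RE to_pullbackK //.
split=> //; first exact: QM'.
  move=> utM; have : 1 \in M by rewrite -utm rpredD.
  by rewrite idealr1.
by move=> Qm; apply: Q1; rewrite -utm; apply: QD => //; apply: QM'.
Qed.

Lemma contractE Q x : ((val : R -> T) @^-1` Q) x = Q (val x).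
Proof. by []. Qed.

(** [Q] is recovered from its trace: for [m] in [M] outside the prime [Q'], the
    set [m Q] lies in the trace of [Q]. *)
Lemma contract_sub Q Q' : ideal Q -> maximal_t_ideal Q' -> ~ (Q' `<=` M_in_T) ->
  val @^-1` Q `<=` (val : R -> T) @^-1` Q' -> Q `<=` Q'.
Proof.
move=> [_ _ QM] mQ' Q'M QQ' t Qt.
have [q [m [_ _ mM Q'm _]]] := maximal_not_in_M Q' mQ' Q'M.
have : Q' (m * t).
  have mtM : t * m \in M by apply: idealMr.
  rewrite mulrC -(@to_pullback_MK T M D _ mtM); apply: QQ'.
  by rewrite contractE to_pullback_MK // mulrC; apply: QM.
by case/(maximal_t_ideal_prime _ _ _ mQ').
Qed.

Lemma proper_contract Q : maximal_t_ideal Q -> ~ (Q `<=` M_in_T) ->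
  proper_t_ideal ((val : R -> T) @^-1` Q).
Proof.
move=> mQ QM; have [q [m [Qq qM mM Qm _]]] := maximal_not_in_M Q mQ QM.
have [/proper_t_idealP[tQ Q1] _] := mQ.
have /t_idealP[[Q0 QD QM'] _ tQ'] := tQ.
apply/proper_t_idealP; split; last by rewrite contractE rmorph1.
apply/t_idealP; split.
- split=> [|x y Qx Qy|a x Qx]; rewrite contractE.
  + by rewrite rmorph0.
  + by rewrite subdomain_valD; apply: QD.
  + by rewrite subdomain_valM; apply: QM'.
- exists q => //; apply/eqP => q0; apply: qM.
  by rewrite M_in_RE q0 rmorph0 rpred0.
move=> s sQ x /(v_hull_pullback_ext _ _ _ mM) sx.
have : Q (m * val x).
  by apply: (tQ' (map val s)) sx => _ /mapP[c /sQ Qc ->].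
by case/(maximal_t_ideal_prime _ _ _ mQ).
Qed.

(** This is the ideal (N : M) of [T], which lies over [N]. *)
Lemma t_ideal_extend N : maximal_t_ideal N -> ~ (M_in_R `<=` N) ->
  t_ideal [set t | forall m, m \in M -> N (to_pullback (t * m))].
Proof.
move=> mN /existsNP[m1 /not_implyP[m1M Nm1]].
have [/proper_t_idealP[tN N1] _] := mN.
have /t_idealP[[N0 ND NM] [n Nn n0] tN'] := tN.
apply/t_idealP; split.
- split=> [m mM|x y Nx Ny m mM|a x Nx m mM].
  + rewrite mul0r (_ : to_pullback 0 = 0) //; apply: val_inj.
    by rewrite to_pullback_MK ?rmorph0 ?rpred0.
  + rewrite (_ : to_pullback _ = to_pullback (x * m) + to_pullback (y * m)).
      by apply: ND; [apply: Nx|apply: Ny].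
    apply: val_inj; rewrite subdomain_valD !to_pullback_MK ?idealMr //.
    by rewrite mulrDl.
  + rewrite mulrAC mulrC; apply: Nx; apply: idealMr => //.
- exists (val n).
    move=> m mM; rewrite (_ : to_pullback _ = to_pullback m * n).
      exact: NM.
    by apply: val_inj; rewrite subdomain_valM !to_pullback_MK ?idealMr // mulrC.
  by rewrite subdomain_val_eq0.
move=> s sN t st m mM.
have tm1M : t * val m1 \in M by apply: idealMr.
have tmM : t * m \in M by apply: idealMr.
have : N (to_pullback (t * val m1 * val m1)).
  apply: tN' (v_hull_pullback_contract _ _ _ m1M st).
  by move=> _ /mapP[c /sN Nc ->]; apply: Nc.
rewrite (_ : to_pullback _ = to_pullback (t * val m1) * m1); last first.
  by apply: val_inj; rewrite subdomain_valM !to_pullback_MK ?idealMr.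
case/(maximal_t_ideal_prime _ _ _ mN) => // Ntm1.
suff : N (to_pullback (t * m) * m1) by case/(maximal_t_ideal_prime _ _ _ mN).
rewrite (_ : _ * m1 = to_pullback m * to_pullback (t * val m1)).
  exact: NM.
by apply: val_inj; rewrite !subdomain_valM !to_pullback_MK //; ring.
Qed.

(** A maximal t-ideal of [T] above (N : M) has a proper t-ideal as its trace,
    which contains [N] and so equals it. *)
Lemma maximal_extend N : maximal_t_ideal N -> ~ (M_in_R `<=` N) ->
    ~ (N `<=` M_in_R) ->
  exists Q, [/\ maximal_t_ideal Q, ~ (Q `<=` M_in_T) & N = val @^-1` Q].
Proof.
move=> mN MN NM; have [/proper_t_idealP[tN N1] Nmax] := mN.
have /t_idealP[[N0 ND NMl] _ _] := tN.
have [Q mQ NQ] : exists2 Q, maximal_t_ideal Q &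
    [set t | forall m, m \in M -> N (to_pullback (t * m))] `<=` Q.
  apply: exists_maximal_t_ideal; apply/proper_t_idealP.
  split; first exact: t_ideal_extend.
  move=> N'1; apply: MN => x xM; have := N'1 _ xM.
  rewrite mul1r (_ : to_pullback _ = x) //; apply: val_inj.
  exact: to_pullback_MK.
have {}NQ : N `<=` val @^-1` Q.
  move=> x Nx; apply: NQ => m mM.
  rewrite (_ : to_pullback _ = to_pullback m * x); first exact: NMl.
  by apply: val_inj; rewrite subdomain_valM !to_pullback_MK ?idealMr // mulrC.
have QM : ~ (Q `<=` M_in_T) by move=> QM; apply: NM => x /NQ/QM.
exists Q; split=> //; rewrite (Nmax (val @^-1` Q)) //.
exact: proper_contract.
Qed.

(** A maximal t-ideal [N] above the trace of [Q] cannot contain [M], since [Q]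
    and [M] are comaximal; so [N] is the trace of some [Q'], and [Q] is
    contained in [Q']. *)
Lemma maximal_contract Q : maximal_t_ideal Q -> ~ (Q `<=` M_in_T) ->
  maximal_t_ideal ((val : R -> T) @^-1` Q).
Proof.
move=> mQ QM; split; first exact: proper_contract.
move=> I pI QI; have [N mN IN] := exists_maximal_t_ideal I pI.
have [/proper_t_idealP[[[N0 ND NMl] _ _] N1] Nmax] := mN.
have [q [m [Qq qM mM Qm qm1]]] := maximal_not_in_M Q mQ QM.
have MN : ~ (M_in_R `<=` N).
  move=> MN; apply: N1; rewrite (_ : 1 = q + to_pullback m).
    by apply: ND; [apply/IN/QI | apply: MN; rewrite M_in_RE to_pullback_MK].
  by apply: val_inj; rewrite subdomain_valD to_pullback_MK // rmorph1.
have NM : ~ (N `<=` M_in_R) by move=> NM; apply/qM/NM/IN/QI.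
have [Q' [mQ' Q'M NE]] := maximal_extend N mN MN NM.
have [[[idQ _ _] _] Qmax] := mQ.
have QQ' : Q' = Q.
  apply: Qmax; first by case: mQ'.
  by apply: contract_sub => //; rewrite -NE; apply: subset_trans IN.
by apply/seteqP; split=> //; rewrite -QQ' -NE.
Qed.

Lemma maximal_cases N : (exists y : residue_field M, y \notin D) ->
  maximal_t_ideal N ->
  [\/ exists2 P, maximal_t_ideal P & N = psi @^-1` P, N = M_in_R |
      exists Q, [/\ maximal_t_ideal Q, ~ (Q `<=` M_in_T) & N = val @^-1` Q]].
Proof.
move=> Dk mN; have [pN Nmax] := mN; have [/t_idealP[_ [n Nn n0] _] _] := pN.
have [NM|NM] := pselect (N `<=` M_in_R).
  constructor 2; apply/esym/Nmax => //; apply/proper_t_idealP.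
  split; last exact: one_notin_M_in_R.
  have n0' : val n != 0 by rewrite subdomain_val_eq0.
  by apply: t_ideal_M_in_R n0' => //; apply: NM.
have [MN|MN] := pselect (M_in_R `<=` N).
  by constructor 1; apply: maximal_above_M.
by constructor 3; apply: maximal_extend.
Qed.

(** * Transfer of t-potency *)

Lemma psi_preimage_inj P P' : psi @^-1` P = psi @^-1` P' -> P = P'.
Proof.
move=> PP'; apply/seteqP; split=> d; have [x <-] := psi_surj d.
  by rewrite -[P _]/((psi @^-1` P) x) PP'.
by rewrite -[P' _]/((psi @^-1` P') x) -PP'.
Qed.

Lemma M_in_R_sub_psi_preimage P : ideal P -> M_in_R `<=` psi @^-1` P.
Proof.
move=> [P0 _ _] x; rewrite M_in_RE -psi_eq0 => /eqP.
by rewrite /preimage /= => ->.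
Qed.

Lemma contract_inj Q Q' : maximal_t_ideal Q -> ~ (Q `<=` M_in_T) ->
  maximal_t_ideal Q' -> ~ (Q' `<=` M_in_T) ->
  (val : R -> T) @^-1` Q = val @^-1` Q' -> Q = Q'.
Proof.
move=> mQ QM mQ' Q'M QQ'; have [[[idQ _ _] _] _] := mQ.
have [[[idQ' _ _] _] _] := mQ'.
apply/seteqP; split.
  by apply: (contract_sub Q Q') => //; rewrite QQ'.
by apply: (contract_sub Q' Q) => //; rewrite QQ'.
Qed.

Lemma t_potent_psi_preimage P : (exists y : residue_field M, y \notin D) ->
  maximal_t_ideal P -> t_potent_ideal P <-> t_potent_ideal (psi @^-1` P).
Proof.
move=> Dk mP; have [[/t_idealP[idP [d Pd d0] _] _] _] := mP.
split=> /t_potent_idealP[_ [s sP sPu]]; apply/t_potent_idealP; split=> //.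
- exact: maximal_psi_preimage.
- have [g gK] := choice (@psi_surj T M D).
  have eM : val (g d) \notin M by rewrite -psi_eq0 gK.
  have [u [m [mM ue]]] := comaximal_M _ eM.
  (* [g d] excludes [M], and [g d] with [m] excludes the traces from [T]. *)
  exists [:: g d, to_pullback m & map g s].
    move=> c; rewrite !inE => /or3P[/eqP->|/eqP->|/mapP[y /sP Py ->]].
    + by rewrite /preimage /= gK.
    + by apply: (M_in_R_sub_psi_preimage P idP); rewrite M_in_RE to_pullback_MK.
    + by rewrite /preimage /= gK.
  move=> N mN sN; have Nd : N (g d) by apply: sN; rewrite inE eqxx.
  have Nm : N (to_pullback m) by apply: sN; rewrite !inE eqxx orbT.
  have [[P' mP' NE]|NE|[Q [mQ QM NE]]] := maximal_cases N Dk mN.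
  + rewrite NE; congr (_ @^-1` _); apply: sPu => // c cs.
    have : N (g c) by apply: sN; rewrite !inE map_f ?orbT.
    by rewrite NE /preimage /= gK.
  + by move: Nd; rewrite NE M_in_RE (negPf eM).
  + (* Q contains both terms of the relation u * g d + m = 1 *)
    have [/proper_t_idealP[[[_ QD QM'] _ _] Q1] _] := mQ.
    case: Q1; rewrite -ue; apply: QD.
      by apply: QM'; move: Nd; rewrite NE.
    by move: Nm; rewrite NE contractE to_pullback_MK.
- exists (map psi s) => [_ /mapP[c /sP Pc ->] //|P' mP' sP'].
  apply/psi_preimage_inj/sPu; first exact: maximal_psi_preimage.
  by move=> c cs; apply/sP'/map_f.
Qed.

(** Take [q] in [Q] and [m] in [M] with [q + m = 1]. A prime that contains [q]
    does not contain [m], so it contains [m * c] only if it contains [c]; this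
    moves the elements [c] of [T] into the pullback. In the other direction
    [q] excludes the ideals inside [M]. *)
Lemma t_potent_contract Q : (exists y : residue_field M, y \notin D) ->
  maximal_t_ideal Q -> ~ (Q `<=` M_in_T) ->
  t_potent_ideal Q <-> t_potent_ideal ((val : R -> T) @^-1` Q).
Proof.
move=> Dk mQ QM; have [[[[_ _ QMl] _ _] _] _] := mQ.
have [q [m [Qq qM mM Qm qm1]]] := maximal_not_in_M Q mQ QM.
split=> /t_potent_idealP[_ [s sQ sQu]]; apply/t_potent_idealP; split=> //.
- exact: maximal_contract.
- have mcM c : m * c \in M by rewrite mulrC idealMr.
  exists (q :: [seq to_pullback (m * c) | c <- s]).
    move=> c; rewrite inE => /predU1P[->//|/mapP[y /sQ Qy ->]].
    by rewrite contractE to_pullback_MK //; apply: QMl.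
  move=> N mN sN; have Nq : N q by apply: sN; rewrite inE eqxx.
  have [/proper_t_idealP[[[_ ND _] _ _] N1] _] := mN.
  have Nm : ~ N (to_pullback m).
    move=> Nm; apply: N1; rewrite (_ : 1 = q + to_pullback m); first exact: ND.
    by apply: val_inj; rewrite subdomain_valD to_pullback_MK // rmorph1.
  have MN : ~ (M_in_R `<=` N).
    by move=> MN; apply/Nm/MN; rewrite M_in_RE to_pullback_MK.
  have [[P mP NE]|NE|[Q' [mQ' Q'M NE]]] := maximal_cases N Dk mN.
  + case: MN; rewrite NE; apply: M_in_R_sub_psi_preimage.
    by case: mP => [[[]]].
  + by case: MN; rewrite NE.
  + rewrite NE; congr (_ @^-1` _); apply: sQu => // c cs.
    have : N (to_pullback (m * c)).
      by apply/sN; rewrite inE (map_f (fun c => to_pullback (m * c)) cs) orbT.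
    rewrite NE contractE to_pullback_MK //.
    case/(maximal_t_ideal_prime _ _ _ mQ') => // Q'm.
    by case: Nm; rewrite NE contractE to_pullback_MK.
- exists (val q :: map val s).
    by move=> c; rewrite inE => /predU1P[->//|/mapP[y /sQ Qy ->]].
  move=> Q' mQ' sQ'; have Q'q : Q' (val q) by apply: sQ'; rewrite inE eqxx.
  have Q'M : ~ (Q' `<=` M_in_T) by move=> Q'M; apply/qM/Q'M.
  apply: (contract_inj Q' Q) => //; apply: sQu; first exact: maximal_contract.
  by move=> c cs; apply: sQ'; rewrite inE map_f ?orbT.
Qed.

Lemma maximal_t_ideal_M_in_T : t_ideal M_in_T -> maximal_t_ideal M_in_T.
Proof.
move=> tM; split.
  by apply/proper_t_idealP; split=> //; apply/negP; rewrite idealr1.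
move=> Q /proper_t_idealP[[idQ _ _] Q1] MQ; apply/seteqP; split=> //.
by apply: contrapT => QM; apply: Q1; apply: (ideal_M_one Q idQ MQ QM).
Qed.

(** The t-closure of [M] then strictly contains the maximal ideal [M], so it is
    the unit ideal, and by finite character a finite subset of [M] shows it. *)
Lemma not_t_ideal_M_in_T : ~ t_ideal M_in_T -> (exists2 m, m \in M & m != 0) ->
  exists2 s : seq T, forall c, c \in s -> c \in M & v_hull s 1.
Proof.
move=> ntM nzM; apply: contrapT => noS; apply/ntM/t_idealP; split=> //.
  split=> [|x y xM yM|a x xM]; rewrite /M_in_T /= ?rpred0 ?rpredD //.
  exact: idealMr.
move=> s sM t st; apply: contrapT => /negP tM.
have [u [m [mM ut]]] := comaximal_M t tM.
apply: noS; exists (m :: s).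
  by move=> c; rewrite inE => /predU1P[->|/sM].
rewrite -ut; apply: v_hullD; last exact/mem_v_hull/mem_head.
apply/v_hullMl/(v_hull_sub s) => // c cs; by rewrite inE cs orbT.
Qed.

Lemma t_potent_M_in_R : (exists y : residue_field M, y \notin D) ->
  GRing.field_axiom DD -> maximal_t_ideal M_in_R ->
  (t_ideal M_in_T -> t_potent_ideal M_in_T) <-> t_potent_ideal M_in_R.
Proof.
move=> Dk fD mMR; split=> [MTpot|/t_potent_idealP[_ [s sM sMu]] tM].
  have [s sM sMu] : exists2 s : seq T, forall c, c \in s -> c \in M &
      forall Q, maximal_t_ideal Q -> (forall c, c \in s -> Q c) ->
        Q `<=` M_in_T.
    have [tM|ntM] := pselect (t_ideal M_in_T).
      have /t_potent_idealP[_ [s sM sMu]] := MTpot tM.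
      by exists s => // Q mQ /(sMu _ mQ) ->.
    have [|s sM s1] := not_t_ideal_M_in_T ntM.
      have [[/t_idealP[_ [n nM n0] _] _] _] := mMR.
      exists (val n); first exact: nM.
      by rewrite subdomain_val_eq0.
    exists s => // Q [/proper_t_idealP[/t_idealP[_ _ tQ] Q1] _] sQ.
    by case: Q1; apply: tQ sQ _ s1.
  apply/t_potent_idealP; split=> //; exists (map to_pullback s).
    by move=> _ /mapP[c /sM cM ->]; rewrite M_in_RE to_pullback_MK.
  move=> N mN sN; have [[P mP _]|//|[Q [mQ QM NE]]] := maximal_cases N Dk mN.
    by case: (field_no_proper_t_ideal P fD); case: mP.
  case: QM; apply: sMu => // c cs; have := sN _ (map_f _ cs).
  by rewrite NE contractE to_pullback_MK // sM.
have mMT := maximal_t_ideal_M_in_T tM.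
apply/t_potent_idealP; split=> //; exists (map val s).
  by move=> _ /mapP[c /sM cM ->].
move=> Q mQ sQ; have [QM|QM] := pselect (Q `<=` M_in_T).
  by case: mQ => pQ Qmax; apply/esym/Qmax => //; case: mMT.
have QE : val @^-1` Q = M_in_R.
  apply: sMu; first exact: maximal_contract.
  by move=> c cs; apply/sQ/map_f.
have [[[idQ _ _] _] _] := mQ; have [_ MTmax] := mMT.
apply: MTmax; first by case: mQ.
move=> m mM; have : M_in_R (to_pullback m) by rewrite M_in_RE to_pullback_MK.
by rewrite -QE contractE to_pullback_MK.
Qed.

End PullbackMaximal.

Theorem theorem4p2 (T : idomainType) (M : maximal_idealr T)
    (D : subringClosed (residue_field M))
    (D_proper : exists x : residue_field M, x \notin D) :
  t_potent_domain (subdomain (pullback D)) <->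
  [/\ t_potent_domain (subdomain D) \/ GRing.field_axiom (subdomain D),
      forall N : set T,
        maximal_t_ideal N -> ~ (N `<=` [set` M]) -> t_potent_ideal N
    & GRing.field_axiom (subdomain D) ->
        t_ideal [set` M] -> t_potent_ideal [set` M]].
Proof.
split=> [Rpot|[Dpot Tpot Mpot] N mN].
  split=> [|Q mQ QM|fD tM].
  - left=> P mP; apply/(t_potent_psi_preimage P D_proper mP).
    exact/Rpot/maximal_psi_preimage.
  - apply/(t_potent_contract Q D_proper mQ QM).
    exact/Rpot/maximal_contract.
  - have /t_idealP[_ [m mM m0] _] := tM.
    have mMR := maximal_t_ideal_M_in_R fD (t_ideal_M_in_R m D_proper mM m0).
    exact: (t_potent_M_in_R D_proper fD mMR).2 (Rpot _ mMR) tM.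
have [[P mP NE]|NE|[Q [mQ QM NE]]] := maximal_cases N D_proper mN.
- rewrite NE; apply/(t_potent_psi_preimage P D_proper mP).
  case: Dpot => [|fD]; first exact.
  by case: (field_no_proper_t_ideal P fD); case: mP.
- rewrite NE in mN *; have fD := field_of_maximal_M_in_R mN.
  exact/(t_potent_M_in_R D_proper fD mN)/Mpot.
- by rewrite NE; apply/(t_potent_contract Q D_proper mQ QM)/Tpot.
Qed.
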